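(* The logic $\mathsf{C2.FS}$ is weakly complete for finite $\omega$-sequence frames: for every $p\in\mathcal{L}_>$, if $p$ is true at every element of every order model based on a finite $\omega$-sequence frame, then $\vdash_{\mathsf{C2.FS}}p$.
   Context: Language. Let $At=\{p_0,p_1,\ldots\}$ be a countably infinite set of atoms. $\mathcal{L}_>$ is generated by $p ::= p_k\in At\mid \neg p\mid (p\wedge p)\mid (p>p)$; $\vee,\to,\leftrightarrow$ are defined as usual; $\Box p$ abbreviates $\neg p>p$. Logics. $\mathsf{C2}$ is the smallest set of $\mathcal{L}_>$-sentences containing all instances of: (PC) every (substitution instance of a) theorem of classical propositional logic; (Identity) $p>p$; (Reciprocity) $(p>q)\wedge(q>p)\wedge(p>r)\to(q>r)$; (MP) $(p>q)\to(p\to q)$; (CEM) $(p>q)\vee(p>\neg q)$; and closed under (Detachment) from $\vdash p\to q$ and $\vdash p$ infer $\vdash q$; (Normality) from $\vdash(p\wedge q)\to r$ infer $\vdash((s>p)\wedge(s>q))\to(s>r)$. $\mathsf{C2.FS}$ is the smallest extension of $\mathsf{C2}$ closed under Detachment and Normality and containing every instance of (Flattening) $(p>((p\wedge q)>r))\leftrightarrow((p\wedge q)>r)$ and of (Sequentiality) $\Box(p\to(\neg p>r))\wedge\Box(q\to(\neg q>r))\to((p\vee q)\to(\neg(p\vee q)>r))$. $\vdash_{\mathsf{C2.FS}}p$ means $p\in\mathsf{C2.FS}$. Order frames and models. An order frame is a pair $\langle W,<\rangle$ where $W\neq\varnothing$ and $<$ is a function taking each $w\in W$ to a strict well-order $<_w$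 on some subset of $W$ such that whenever $x<_w y$, either $w=x$ or $w<_w x$. Put $R(w)=\{w\}\cup\{v: w<_w v\}$. An order model $\langle W,<,V\rangle$ adds a valuation $V:At\times W\to\{0,1\}$; put $V(p_k)=\{w:V(p_k,w)=1\}$. Denotations: $[\![p_k]\!]=V(p_k)$, $[\![\neg p]\!]=W\setminus[\![p]\!]$, $[\![p\wedge q]\!]=[\![p]\!]\cap[\![q]\!]$, and $w\in[\![p>q]\!]$ iff either $R(w)\cap[\![p]\!]=\varnothing$, or there is $y\in R(w)\cap[\![p]\!]\cap[\![q]\!]$ such that $x\notin[\![p]\!]$ whenever $x<_w y$. A sentence $p$ is true at $w$ iff $w\in[\![p]\!]$. $\omega$-sequence frames. An $\omega$-sequence over a non-empty set $P$ is a function $\sigma:\omega\to P$; its $n$th tail $\sigma^{[n:]}$ is the $\omega$-sequence $k\mapsto\sigma(n+k)$; the rank in $\sigma$ of a tail $\tau$ of $\sigma$ is the least $n$ with $\tau=\sigma^{[n:]}$. The tail order function $\prec^W$ on a set $W$ of sequences has $\tau\prec^W_\sigma\rho$ iff $\tau,\rho,\sigma\in W$, $\tau$ and $\rho$ are tails of $\sigma$, and the rank of $\tau$ in $\sigma$ is less than the rank of $\rho$ in $\sigma$. An $\omega$-sequence frame is an order frame $\langle W,\prec^W\rangle$ where $W$ is a set of $\omega$-sequences over some set $P$ that is closed under tails. It is finite iff $W$ is finite. *)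

(* Defs.v *)
From mathcomp Require Import all_boot.
From mathcomp Require Import boolp classical_sets functions cardinality.

Set Implicit Arguments.
Unset Strict Implicit.
Unset Printing Implicit Defensive.

Local Open Scope classical_set_scope.

Inductive form : Type :=
  | Atom of nat
  | Neg of form
  | And of form & form
  | Cond of form & form.

Declare Scope form_scope.
Delimit Scope form_scope with form.
Bind Scope form_scope with form.

Notation "¬ p" := (Neg p)
  (at level 75, right associativity) : form_scope.
Notation "p ∧ q" := (And p q)
  (at level 80, right associativity) : form_scope.
Notation "p ▷ q" := (Cond p q)
  (at level 70, no associativity) : form_scope.

Definition Or (p q : form) : form := (¬ ((¬ p) ∧ (¬ q)))%form.
Definition Imp (p q : form) : form := (¬ (p ∧ (¬ q)))%form.

Notation "p ∨ q" := (Or p q)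
  (at level 85, right associativity) : form_scope.
Notation "p → q" := (Imp p q)
  (at level 99, q at level 200, right associativity) : form_scope.

Definition Iff (p q : form) : form := ((p → q) ∧ (q → p))%form.
Definition Box (p : form) : form := ((¬ p) ▷ p)%form.

Notation "p ↔ q" := (Iff p q)
  (at level 95, no associativity) : form_scope.
Notation "□ p" := (Box p)
  (at level 75, right associativity) : form_scope.

(* Classical propositional logic has its own syntax, so that the axiom scheme
   PC below is literally "substitution instance of a propositional theorem";
   its theorems are the two-valued tautologies. *)
Inductive prop_form : Type :=
  | PVar of nat
  | PNeg of prop_form
  | PAnd of prop_form & prop_form.

Fixpoint prop_eval (v : nat -> bool) (a : prop_form) : bool :=
  match a with
  | PVar k => v k
  | PNeg a => ~~ prop_eval v a
  | PAnd a b => prop_eval v a && prop_eval v b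
  end.

Definition tautology (a : prop_form) : Prop := forall v, prop_eval v a.

Fixpoint prop_subst (s : nat -> form) (a : prop_form) : form :=
  match a with
  | PVar k => s k
  | PNeg a => Neg (prop_subst s a)
  | PAnd a b => And (prop_subst s a) (prop_subst s b)
  end.

Inductive C2 : form -> Prop :=
  | C2_PC (a : prop_form) (s : nat -> form) :
      tautology a -> C2 (prop_subst s a)
  | C2_Identity p : C2 (p ▷ p)
  | C2_Reciprocity p q r :
      C2 (((p ▷ q) ∧ (q ▷ p) ∧ (p ▷ r)) → (q ▷ r))
  | C2_MP p q : C2 ((p ▷ q) → (p → q))
  | C2_CEM p q : C2 ((p ▷ q) ∨ (p ▷ (¬ q)))
  | C2_Detachment p q : C2 (p → q) -> C2 p -> C2 q
  | C2_Normality p q r s :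
      C2 ((p ∧ q) → r) -> C2 (((s ▷ p) ∧ (s ▷ q)) → (s ▷ r)).

Inductive C2FS : form -> Prop :=
  | C2FS_C2 p : C2 p -> C2FS p
  | C2FS_Flattening p q r :
      C2FS ((p ▷ ((p ∧ q) ▷ r)) ↔ ((p ∧ q) ▷ r))
  | C2FS_Sequentiality p q r :
      C2FS (((□ (p → ((¬ p) ▷ r))) ∧ (□ (q → ((¬ q) ▷ r))))
            → ((p ∨ q) → ((¬ (p ∨ q)) ▷ r)))
  | C2FS_Detachment p q : C2FS (p → q) -> C2FS p -> C2FS q
  | C2FS_Normality p q r s :
      C2FS ((p ∧ q) → r) -> C2FS (((s ▷ p) ∧ (s ▷ q)) → (s ▷ r)).

Record strict_well_order_on (T : Type) (D : set T) (r : T -> T -> Prop) :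
    Prop := StrictWellOrderOn {
  swo_field : forall x y, r x y -> D x /\ D y;
  swo_irrefl : forall x, ~ r x x;
  swo_trans : forall x y z, r x y -> r y z -> r x z;
  swo_total : forall x y, D x -> D y -> [\/ r x y, x = y | r y x];
  swo_least : forall S : set T, S `<=` D -> S !=set0 ->
    exists2 x, S x & forall y, S y -> x = y \/ r x y
}.

(* [precedes F w x y] is x <_w y. *)
Record order_frame : Type := OrderFrame {
  world :> Type;
  precedes : world -> world -> world -> Prop;
  world_neq0 : [set: world] !=set0;
  precedes_wo : forall w, exists D, strict_well_order_on D (precedes w);
  precedes_first : forall w x y,
    precedes w x y -> w = x \/ precedes w w x
}.

Definition accessible (F : order_frame) (w : F) : set F :=
  [set w] `|` [set v | precedes w w v].

Record order_model : Type := OrderModel {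
  model_frame :> order_frame;
  valuation : nat -> model_frame -> bool
}.

Fixpoint denotation (M : order_model) (p : form) : set M :=
  match p with
  | Atom k => [set w | valuation k w]
  | Neg p => ~` @denotation M p
  | And p q => @denotation M p `&` @denotation M q
  | Cond p q =>
      [set w | accessible w `&` @denotation M p = set0 \/
        exists2 y, (accessible w `&` @denotation M p `&` @denotation M q) y &
          forall x, precedes w x y -> ~ @denotation M p x]
  end.

Arguments denotation : clear implicits.

Definition true_at (M : order_model) (w : M) (p : form) : Prop :=
  denotation M p w.

Section Tails.
Variable P : Type.
Implicit Types (s t u : nat -> P).

Definition tail n s : nat -> P := fun k => s (n + k).

(* In particular t is then a tail of s. *)
Definition is_rank s t n : Prop :=
  t = tail n s /\ forall m, t = tail m s -> n <= m.

Definition tail_order (W : set (nat -> P)) s t u : Prop :=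
  [/\ W t, W u, W s &
      exists m n, [/\ is_rank s t m, is_rank s u n & m < n]].

Lemma tail0 s : tail 0 s = s.
Proof. by apply/funext => k; rewrite /tail add0n. Qed.

Lemma rank_uniq s t m n : is_rank s t m -> is_rank s t n -> m = n.
Proof.
by move=> [tm lem] [tn len]; apply/eqP; rewrite eqn_leq lem// len.
Qed.

Lemma rank_exists s n : exists m, is_rank s (tail n s) m.
Proof.
have ex : exists m, `[< tail n s = tail m s >] by exists n; apply/asboolP.
case: (ex_minnP ex) => m /asboolP eqm minm.
by exists m; split=> // k eqk; apply: minm; apply/asboolP.
Qed.

End Tails.

(* The underlying set P is non-empty because [seqs] is. *)
Record omega_frame : Type := OmegaFrame {
  omega_base : Type;
  seqs : set (nat -> omega_base);
  seqs_neq0 : seqs !=set0;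
  seqs_tail : forall s n, seqs s -> seqs (tail n s)
}.

Arguments seqs : clear implicits.

Definition finite_omega_frame (F : omega_frame) : Prop := finite_set (seqs F).

Section OmegaOrderFrame.
Variable F : omega_frame.

Definition omega_precedes (s t u : seqs F) : Prop :=
  tail_order (seqs F) (val s) (val t) (val u).

Lemma omega_neq0 : [set: seqs F] !=set0.
Proof. by have [s Fs] := seqs_neq0 F; exists (SigSub (mem_set Fs)). Qed.

Lemma omega_precedes_wo (s : seqs F) :
  exists D, strict_well_order_on D (omega_precedes s).
Proof.
have inF (t : seqs F) : seqs F (val t) by apply: set_mem; exact: valP.
exists [set t | exists n, is_rank (val s) (val t) n]; split.
- by move=> t u [_ _ _ [m [n [tm un _]]]]; split; [exists m|exists n].
- move=> t [_ _ _ [m [n [tm tn]]]].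
  by rewrite (rank_uniq tm tn) ltnn.
- move=> t u v [_ _ _ [m [n [tm un mn]]]] [_ _ _ [n' [k [un' vk nk]]]].
  split=> //; exists m, k; split=> //.
  by rewrite (rank_uniq un' un) in nk; exact: ltn_trans nk.
- move=> t u [m tm] [n un]; have [mn|nm|mn] := ltngtP m n.
  + by apply: Or31; split=> //; exists m, n.
  + by apply: Or33; split=> //; exists n, m.
  + by apply: Or32; apply: val_inj; case: tm un => -> _ [-> _]; rewrite mn.
- move=> S SD [t0 St0].
  have ex : exists n, `[< exists2 t, S t & is_rank (val s) (val t) n >].
    by have [n t0n] := SD _ St0; exists n; apply/asboolP; exists t0.
  case: (ex_minnP ex) => m /asboolP[t St tm] minm.
  exists t => // u Su; have [n un] := SD _ Su.
  have : m <= n by apply: minm; apply/asboolP; exists u.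
  rewrite leq_eqVlt => /orP[/eqP mn|mn].
  + by left; apply: val_inj; case: tm un => -> _ [-> _]; rewrite mn.
  + by right; split=> //; exists m, n.
Qed.

Lemma omega_precedes_first (s t u : seqs F) :
  omega_precedes s t u -> s = t \/ omega_precedes s s t.
Proof.
move=> [Ft _ Fs [[|m] [n [tm _ _]]]].
- by left; apply: val_inj; case: tm => -> _; rewrite tail0.
- right; split=> //; exists 0, m.+1; split=> //.
Qed.

Definition omega_order_frame : order_frame :=
  OrderFrame omega_neq0 omega_precedes_wo omega_precedes_first.

End OmegaOrderFrame.

(* Main.v *)
(* Up to isomorphism, the finite omega-sequence frames are the finite
   functional graphs: the successor of a sequence is its first tail, and
   [p > q] says that [p] never holds along the orbit or that [q] holds at the
   first [p]-point.  Given an unprovable [phi], consider the atoms, that is,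
   the truth assignments to the subformulas of [phi], and let [a -> b] when it
   is consistent that [a] holds and the first exit from [a] lands in [b].
   Flattening makes a conditional [p > q] constant along such steps as long as
   [p] fails.  Sequentiality plays the part of the induction axiom of temporal
   logic: the disjunction [D] of the atoms reachable from [a] satisfies
   [|- D -> Box D], so if [p > q] fails at [a], an atom containing [p] is
   reachable from [a].  A path from an atom refuting [phi] to a terminal
   strongly connected component, followed by a closed walk through all of that
   component, is then a finite functional graph in which every
   point satisfies the atom that labels it. *)

From HB Require Import structures.
From mathcomp Require Import all_boot.
From mathcomp Require Import boolp classical_sets functions cardinality.
Require Import Defs.

Set Implicit Arguments.
Unset Strict Implicit.
Unset Printing Implicit Defensive.

Section Lasso.
Variables (T : finType) (e : rel T).

Lemma terminal_component x :
  exists2 c, connect e x c & forall d, connect e c d -> connect e d c.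
Proof.
case: (arg_minnP (fun c => #|connect e c|) (connect0 e x)) => c xc minc.
exists c => // d cd.
have sub : connect e d \subset connect e c.
  by apply/fintype.subsetP => z; apply: connect_trans cd.
have /subset_cardP/(_ sub) eqdc : #|connect e d| = #|connect e c|.
  by apply/eqP; rewrite eqn_leq (subset_leq_card sub) minc// (connect_trans xc).
by have := eqdc c; rewrite !inE => ->.
Qed.

Lemma closed_walk c :
  (forall d, connect e c d -> connect e d c) -> (exists d, e c d) ->
  exists p, [/\ path e c p, last c p = c & forall d, connect e c d -> d \in p].
Proof.
move=> back [d0 cd0].
have [p [ep lp sp]] : exists p, [/\ path e c p, last c p = c &
    {subset enum (connect e c) <= c :: p}].
  have : {subset enum (connect e c) <= connect e c} by move=> d; rewrite mem_enum.
  elim: (enum _) => [|d s IHs] sub; first by exists [::].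
  have [|p [ep lp sp]] := IHs; first by move=> z zs; apply: sub; rewrite inE zs orbT.
  have cd : connect e c d by apply: sub; rewrite mem_head.
  have /connectP[q1 eq1 ld] := cd; have /connectP[q2 eq2 lc] := back _ cd.
  exists (q1 ++ q2 ++ p); split.
  - by rewrite !cat_path eq1 -ld eq2 -lc.
  - by rewrite !last_cat -ld -lc.
  - move=> z; rewrite inE => /predU1P[->|/sp].
      by rewrite ld -cat_cons mem_cat mem_last.
    by rewrite !inE !mem_cat => /predU1P[->|->]; rewrite ?eqxx ?orbT.
have /connectP[q eq lq] := back _ (connect1 cd0).
exists (d0 :: q ++ p); split.
- by rewrite /= cd0 cat_path eq -lq.
- by rewrite /= last_cat -lq.
- move=> d cd; have /sp : d \in enum (connect e c) by rewrite mem_enum.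
  rewrite inE -cat_cons mem_cat => /predU1P[->|->]; last by rewrite orbT.
  by rewrite {1}lq mem_last.
Qed.

Lemma lasso x : (forall y, connect e x y -> exists z, e y z) ->
  exists (I : finType) (S : I -> I) (L : I -> T) (i0 : I) (c : T),
  [/\ L i0 = x, forall i, e (L i) (L (S i)) &
      forall i d, connect e c d -> exists k, L (iter k S i) = d].
Proof.
move=> serial; have [c xc back] := terminal_component x.
have [p [ep lp allp]] := closed_walk back (serial _ xc).
have /connectP[q eq lq] := xc.
have p0 : 0 < size p by case: (p) (allp c (connect0 e c)).
pose N := size q + size p; pose s := q ++ p.
have szs : size s = N by rewrite size_cat.
pose f (i : nat) := if i < N then i.+1 else (size q).+1.
have fN i : f i < N.+1.
  by rewrite /f; case: ifP => // _; rewrite ltnS /N -[X in X < _]addn0 ltn_add2l.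
pose S (i : 'I_N.+1) := Ordinal (fN i).
pose L (i : 'I_N.+1) := nth x (x :: s) i.
have Sadd k (i : 'I_N.+1) : i + k <= N -> iter k S i = i + k :> nat.
  elim: k => [|k IHk] le; first by rewrite addn0.
  rewrite addnS in le *; rewrite iterS /= IHk ?(ltnW le)//.
  by rewrite /f le.
have es : path e x s by rewrite cat_path eq -lq.
have eL i : i < N -> e (nth x (x :: s) i) (nth x s i).
  by move=> iN; apply/(pathP x es); rewrite szs.
exists 'I_N.+1, S, L, ord0, c; split=> //.
- move=> i; rewrite /L /= /f; case: ifPn => [/eL//|]; rewrite -leqNgt => Ni.
  have -> : nat_of_ord i = N by apply/eqP; rewrite eqn_leq Ni -ltnS ltn_ord.
  have -> : nth x (x :: s) N = nth x (x :: s) (size q).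
    rewrite -{1}szs nth_last /= /s last_cat -lq lp.
    by rewrite -cat_cons nth_cat /= ltnS leqnn -[size q]/(size (x :: q)).-1 nth_last /= lq.
  by apply: eL; rewrite -[X in X < _]addn0 ltn_add2l.
- move=> i d /allp dp; pose j := (index d p) + (size q).+1.
  have jN : j <= N by rewrite /j addnS -addSn /N addnC leq_add2l index_mem.
  exists (j - (size q).+1 + 1 + (N - i)).
  have iN : i <= N by rewrite -ltnS.
  rewrite !iterD /=.
  have e1 : iter (N - i) S i = N :> nat by rewrite Sadd subnKC.
  set i1 := S _.
  have e2 : i1 = (size q).+1 :> nat by rewrite /i1 /= e1 /f ltnn.
  have qj : (size q).+1 <= j by rewrite /j leq_addl.
  rewrite /L Sadd e2 ?subnKC// /j addnS /= /s nth_cat addnC.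
  by rewrite ltnNge leq_addr /= addKn nth_index.
Qed.

End Lasso.

Section OmegaModel.
Variables (F : omega_frame) (V : nat -> omega_order_frame F -> bool).
Let M := OrderModel V.

Definition shift n (w : seqs F) : seqs F :=
  SigSub (mem_set (seqs_tail n (set_mem (valP w)))).

Lemma val_shift n w : val (shift n w) = tail n (val w).
Proof. by []. Qed.

Lemma accessibleP (w y : M) : accessible w y <-> exists n, y = shift n w.
Proof.
split=> [[->|[_ _ _ [_ [n [_ [yn _] _]]]]]|[n ->]].
- by exists 0; apply: val_inj; rewrite val_shift tail0.
- by exists n; apply: val_inj.
- have Fs (z : seqs F) : seqs F (val z) by apply: set_mem; exact: valP.
  have [k rk] := rank_exists (val w) n; case: k rk => [|k] rk.
    by left; apply: val_inj; rewrite val_shift; case: rk => -> _; rewrite tail0.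
  right; split=> //; exists 0, k.+1; split=> //; split=> //; by rewrite tail0.
Qed.

Lemma denotation_CondP p q (w : M) : denotation M (Cond p q) w <->
  (forall n, ~ denotation M p (shift n w)) \/
  exists n, [/\ denotation M p (shift n w), denotation M q (shift n w) &
    forall m, m < n -> ~ denotation M p (shift m w)].
Proof.
have Fs (z : seqs F) : seqs F (val z) by apply: set_mem; exact: valP.
split=> /= [[w0|[y [[/accessibleP[n yn] py] qy] miny]]|[nop|[n [pn qn minn]]]].
- left=> n pn; suff : (accessible w `&` denotation M p)%classic (shift n w).
    by rewrite w0.
  by split=> //; apply/accessibleP; exists n.
- have [k rk] := rank_exists (val w) n.
  have yk : y = shift k w by rewrite yn; apply: val_inj; rewrite val_shift; case: rk.
  right; exists k; split; rewrite -?yk// => m mk; apply: miny; rewrite yk.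
  have [l rl] := rank_exists (val w) m.
  split=> //; exists l, k; rewrite !val_shift; split=> //.
    by case: (rk) => <-.
  by case: rl => _ /(_ m erefl) lm; apply: leq_ltn_trans mk.
- left; rewrite -subset0 => y [/accessibleP[n ->]]; exact: nop.
- right; exists (shift n w); first by split=> //; split=> //; apply/accessibleP; exists n.
  move=> x [_ _ _ [m [k [[xm _] [_ /(_ n erefl) kn] mk]]]].
  have -> : x = shift m w by apply: val_inj.
  by apply: minn; apply: leq_trans kn.
Qed.

End OmegaModel.

Section FunctionalGraphModel.
Variables (I : finType) (S : I -> I).

Definition orbit_seq (i : I) : nat -> I := fun k => iter k S i.

Lemma tail_orbit_seq n i : tail n (orbit_seq i) = orbit_seq (iter n S i).
Proof. by apply/funext => k; rewrite /tail /orbit_seq addnC iterD. Qed.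

Lemma orbit_seqs_neq0 (i : I) : (range orbit_seq !=set0)%classic.
Proof. by exists (orbit_seq i), i. Qed.

Lemma orbit_seqs_tail s n :
  range orbit_seq s -> range orbit_seq (tail n s).
Proof. by move=> [i _ <-]; rewrite tail_orbit_seq; exists (iter n S i). Qed.

Definition orbit_frame (i0 : I) : omega_frame :=
  OmegaFrame (orbit_seqs_neq0 i0) orbit_seqs_tail.

Lemma orbit_frame_finite i0 : finite_omega_frame (orbit_frame i0).
Proof. exact: finite_image. Qed.

End FunctionalGraphModel.

Record Hintikka_labelling (cl : form -> Prop) (I : Type) (S : I -> I)
    (A : I -> form -> bool) : Prop := HintikkaLabelling {
  closed_Neg : forall p, cl (Neg p) -> cl p;
  closed_And : forall p q, cl (And p q) -> cl p /\ cl q;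
  closed_Cond : forall p q, cl (Cond p q) -> cl p /\ cl q;
  label_Neg : forall i p, cl (Neg p) -> A i (Neg p) = ~~ A i p;
  label_And : forall i p q, cl (And p q) -> A i (And p q) = A i p && A i q;
  label_Cond : forall i p q, cl (Cond p q) -> A i p -> A i (Cond p q) = A i q;
  label_Cond_next : forall i p q, cl (Cond p q) ->
    ~~ A i p -> A i (Cond p q) = A (S i) (Cond p q);
  label_eventually : forall i p q, cl (Cond p q) ->
    ~~ A i (Cond p q) -> exists n, A (iter n S i) p
}.

Section TruthLemma.
Variables (cl : form -> Prop) (I : finType) (S : I -> I).
Variable A : I -> form -> bool.
Hypothesis HA : Hintikka_labelling cl S A.

Lemma label_Cond_iter p q i n : cl (Cond p q) ->
  (forall m, m < n -> ~~ A (iter m S i) p) ->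
  A i (Cond p q) = A (iter n S i) (Cond p q).
Proof.
move=> clpq; elim: n => // n IHn nop.
rewrite IHn => [|m mn]; last by apply: nop; exact: ltnW.
by rewrite (label_Cond_next HA)// nop.
Qed.

Lemma label_CondP p q i : cl (Cond p q) -> A i (Cond p q) <->
  (forall n, ~ A (iter n S i) p) \/
  exists n, [/\ A (iter n S i) p, A (iter n S i) q &
    forall m, m < n -> ~ A (iter m S i) p].
Proof.
move=> clpq; split=> [Apq|].
- have [[n pn]|/forallNP] := pselect (exists n, A (iter n S i) p); last by left.
  have ex : exists n, A (iter n S i) p by exists n.
  case: (ex_minnP ex) => k pk mink; right; exists k.
  have nop m : m < k -> ~ A (iter m S i) p.
    by move=> mk /mink; rewrite leqNgt mk.
  split=> //; rewrite -(label_Cond HA clpq pk) -label_Cond_iter//.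
  by move=> m /nop /negP.
- case=> [nop|[n [pn qn nop]]].
    by apply/negPn/negP => /(label_eventually HA clpq)[n]; exact: nop.
  rewrite (@label_Cond_iter _ _ _ n)//; first by rewrite (label_Cond HA).
  by move=> m /nop /negP.
Qed.

Lemma Hintikka_model i0 : exists F : omega_frame, finite_omega_frame F /\
  exists M : order_model, model_frame M = omega_order_frame F /\
  exists w : M, forall p, cl p -> true_at w p <-> A i0 p.
Proof.
pose F := orbit_frame S i0; exists F; split; first exact: orbit_frame_finite.
pose V k (w : omega_order_frame F) := A (val w 0) (Atom k).
exists (OrderModel V); split=> //.
suff truth p : cl p -> forall w : omega_order_frame F,
    denotation (OrderModel V) p w <-> A (val w 0) p.
  have Fi0 : seqs F (orbit_seq S i0) by exists i0.
  by exists (SigSub (mem_set Fi0)) => p clp; exact: truth.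
have shift0 (w : omega_order_frame F) n : val (shift n w) 0 = iter n S (val w 0).
  rewrite val_shift /tail addn0.
  by have [i _ <-] : range (orbit_seq S) (val w) := set_mem (valP w).
elim: p => [k|p IHp|p IHp q IHq|p IHp q IHq] clp w //.
- rewrite (label_Neg HA)//=; split=> [np|/negP np]; [apply/negP|]; move=> H; apply: np.
    by apply/(IHp (closed_Neg HA clp)).
  by apply/(IHp (closed_Neg HA clp)).
- have [clp1 clp2] := closed_And HA clp.
  rewrite (label_And HA)//=; split=> [[/(IHp clp1)-> /(IHq clp2)->]//|/andP[]].
  by move=> /(IHp clp1) ? /(IHq clp2).
- have [clp1 clp2] := closed_Cond HA clp.
  rewrite denotation_CondP label_CondP//.
  have ep n : denotation (OrderModel V) p (shift n w) <-> A (iter n S (val w 0)) p.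
    by rewrite (IHp clp1) shift0.
  have eq n : denotation (OrderModel V) q (shift n w) <-> A (iter n S (val w 0)) q.
    by rewrite (IHq clp2) shift0.
  split=> [[nop|[n [pn qn nop]]]|[nop|[n [pn qn nop]]]].
  + by left=> n /ep; exact: nop.
  + by right; exists n; split=> [||m mn /ep]; [exact/ep|exact/eq|exact: nop].
  + by left=> n /ep; exact: nop.
  + by right; exists n; split=> [||m mn /ep]; [exact/ep|exact/eq|exact: nop].
Qed.

End TruthLemma.

Fixpoint form_encode (p : form) : GenTree.tree nat :=
  match p with
  | Atom k => GenTree.Leaf k
  | Neg p => GenTree.Node 0 [:: form_encode p]
  | And p q => GenTree.Node 1 [:: form_encode p; form_encode q]
  | Cond p q => GenTree.Node 2 [:: form_encode p; form_encode q]
  end.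

Fixpoint form_decode (t : GenTree.tree nat) : form :=
  match t with
  | GenTree.Leaf k => Atom k
  | GenTree.Node 0 [:: t] => Neg (form_decode t)
  | GenTree.Node 1 [:: t; u] => And (form_decode t) (form_decode u)
  | GenTree.Node 2 [:: t; u] => Cond (form_decode t) (form_decode u)
  | _ => Atom 0
  end.

Lemma form_encodeK : cancel form_encode form_decode.
Proof. by elim=> //= [p ->|p -> q ->|p -> q ->]. Qed.

HB.instance Definition _ := Countable.copy form (can_type form_encodeK).

Fixpoint peval (v : form -> bool) (p : form) : bool :=
  match p with
  | Neg p => ~~ peval v p
  | And p q => peval v p && peval v q
  | _ => v p
  end.

Fixpoint skeleton (p : form) : prop_form :=
  match p with
  | Neg p => PNeg (skeleton p)
  | And p q => PAnd (skeleton p) (skeleton q)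
  | _ => PVar (pickle p)
  end.

Lemma C2FS_taut p : (forall v, peval v p) -> C2FS p.
Proof.
move=> tp; pose s k : form := odflt (Atom 0) (unpickle k).
have sk q : prop_subst s (skeleton q) = q.
  by elim: q => [k|q /= ->|q /= -> r ->|q _ r _]//=; rewrite /s pickleK.
rewrite -(sk p); apply/C2FS_C2/C2_PC => v.
have ev q : prop_eval v (skeleton q) = peval (v \o pickle) q.
  by elim: q => [k|q /= ->|q /= -> r ->|q _ r _].
by rewrite ev.
Qed.

Lemma C2FS_consequence (G : seq form) p : (forall q, q \in G -> C2FS q) ->
  (forall v, all (peval v) G -> peval v p) -> C2FS p.
Proof.
elim: G p => [|q G IHG] p HG Hp; first by apply: C2FS_taut => v; exact: Hp.
apply: (@C2FS_Detachment q); last by apply: HG; rewrite mem_head.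
apply: IHG => [r rG|v vG]; first by apply: HG; rewrite inE rG orbT.
by have /= := Hp v; rewrite vG andbT; case: (peval v q) => //= ->.
Qed.

Lemma C2FS_conseq1 p q : (forall v, peval v p -> peval v q) -> C2FS p -> C2FS q.
Proof.
move=> pq Hp; apply: (@C2FS_consequence [:: p]) => [r|v /=]; last by rewrite andbT => /pq.
by rewrite inE => /eqP->.
Qed.

Lemma C2FS_conseq2 p q r : (forall v, peval v p -> peval v q -> peval v r) ->
  C2FS p -> C2FS q -> C2FS r.
Proof.
move=> pqr Hp Hq; apply: (@C2FS_consequence [:: p; q]) => [s|v /=].
  by rewrite !inE => /orP[]/eqP->.
by rewrite andbT => /andP[]; exact: pqr.
Qed.

Lemma C2FS_conseq3 p q r s :
  (forall v, peval v p -> peval v q -> peval v r -> peval v s) ->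
  C2FS p -> C2FS q -> C2FS r -> C2FS s.
Proof.
move=> pqr Hp Hq Hr; apply: (@C2FS_consequence [:: p; q; r]) => [t|v /=].
  by rewrite !inE => /or3P[]/eqP->.
by rewrite andbT => /and3P[]; exact: pqr.
Qed.

Ltac ptaut := let v := fresh "v" in move=> v /=;
  repeat match goal with
  | |- context [peval v ?p] => case: (peval v p) => //=
  | |- context [v ?p] => case: (v p) => //=
  end.

Lemma Cond_mono s p q : C2FS (Imp p q) -> C2FS (Imp (Cond s p) (Cond s q)).
Proof.
move=> pq; have /(C2FS_Normality s) : C2FS (Imp (And p p) q).
  by apply: C2FS_conseq1 pq; ptaut.
by apply: C2FS_conseq1; ptaut.
Qed.

Lemma Cond_necessitation s p : C2FS p -> C2FS (Cond s p).
Proof.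
move=> Hp; have : C2FS (Imp s p) by apply: C2FS_conseq1 Hp; ptaut.
move=> /(Cond_mono s)/C2FS_Detachment; apply.
exact/C2FS_C2/C2_Identity.
Qed.

Lemma Cond_antecedent p p' q :
  C2FS (Iff p p') -> C2FS (Imp (Cond p q) (Cond p' q)).
Proof.
move=> e; have e1 : C2FS (Imp p p') by apply: C2FS_conseq1 e; ptaut.
have e2 : C2FS (Imp p' p) by apply: C2FS_conseq1 e; ptaut.
have H1 := C2FS_Detachment (Cond_mono p e1) (C2FS_C2 (C2_Identity p)).
have H2 := C2FS_Detachment (Cond_mono p' e2) (C2FS_C2 (C2_Identity p')).
by apply: C2FS_conseq3 H1 H2 (C2FS_C2 (C2_Reciprocity p p' q)); ptaut.
Qed.

Lemma Cond_And s p q : C2FS (Imp (And (Cond s p) (Cond s q)) (Cond s (And p q))).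
Proof. by apply/C2FS_Normality/C2FS_taut; ptaut. Qed.

Lemma Cond_Neg s p : C2FS (Imp (Neg (Cond s p)) (Cond s (Neg p))).
Proof. by apply: C2FS_conseq1 (C2FS_C2 (C2_CEM s p)); ptaut. Qed.

Lemma Cond_centered p q : C2FS (Imp p (Iff (Cond p q) q)).
Proof.
apply: C2FS_conseq3 (C2FS_C2 (C2_MP p q)) (Cond_Neg p q)
  (C2FS_C2 (C2_MP p (Neg q))); ptaut.
Qed.

Lemma Flattening_weaker a p q : C2FS (Imp p (Neg a)) ->
  C2FS (Iff (Cond (Neg a) (Cond p q)) (Cond p q)).
Proof.
move=> pa; have e : C2FS (Iff (And (Neg a) p) p) by apply: C2FS_conseq1 pa; ptaut.
have e' : C2FS (Iff p (And (Neg a) p)) by apply: C2FS_conseq1 pa; ptaut.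
have H1 := Cond_antecedent q e; have H2 := Cond_antecedent q e'.
have H : C2FS (Iff (Cond (And (Neg a) p) q) (Cond p q)).
  by apply: C2FS_conseq2 H1 H2; ptaut.
have H3 : C2FS (Iff (Cond (Neg a) (Cond (And (Neg a) p) q))
    (Cond (Neg a) (Cond p q))).
  by apply: C2FS_conseq2 (Cond_mono (Neg a) H1) (Cond_mono (Neg a) H2); ptaut.
by apply: C2FS_conseq3 H3 (C2FS_Flattening (Neg a) p q) H; ptaut.
Qed.

Lemma Cond_contradiction s p q :
  C2FS (Imp (And (Cond s p) (Cond s (Neg p))) (Cond s q)).
Proof. by apply/C2FS_Normality/C2FS_taut; ptaut. Qed.

Lemma Box_vacuous a p q : C2FS (Imp p (Neg a)) ->
  C2FS (Imp (Box a) (Cond p q)).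
Proof.
move=> pa; apply: C2FS_conseq3 (Flattening_weaker q pa)
  (C2FS_C2 (C2_Identity (Neg a))) (Cond_contradiction (Neg a) a (Cond p q)).
by ptaut.
Qed.

Lemma Sequentiality_rule p q r :
  C2FS (Imp p (Cond (Neg p) r)) -> C2FS (Imp q (Cond (Neg q) r)) ->
  C2FS (Imp (Or p q) (Cond (Neg (Or p q)) r)).
Proof.
move=> Hp Hq; have nec t : C2FS t -> C2FS (Box t) by exact: Cond_necessitation.
apply: C2FS_conseq3 (C2FS_Sequentiality p q r) (nec _ Hp) (nec _ Hq).
by rewrite /Box; ptaut.
Qed.

Definition Top : form := Neg (And (Atom 0) (Neg (Atom 0))).
Definition bigAnd (l : seq form) : form := foldr And Top l.
Definition bigOr (l : seq form) : form := foldr Or (Neg Top) l.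

Lemma peval_bigAnd v l : peval v (bigAnd l) = all (peval v) l.
Proof. by elim: l => /= [|p l ->]//; case: (v _). Qed.

Lemma peval_bigOr v l : peval v (bigOr l) = has (peval v) l.
Proof.
by elim: l => /= [|p l ->]; [case: (v _)|case: (peval v p) => //=; rewrite negbK].
Qed.

Lemma Cond_bigAnd s p l : (forall q, q \in l -> C2FS (Imp p (Cond s q))) ->
  C2FS (Imp p (Cond s (bigAnd l))).
Proof.
elim: l => [_|q l IHl Hl].
  have /(Cond_necessitation s) : C2FS Top by apply: C2FS_taut; ptaut.
  by apply: C2FS_conseq1; ptaut.
have Hq := Hl q (mem_head q l).
have {}IHl : C2FS (Imp p (Cond s (bigAnd l))).
  by apply: IHl => r rl; apply: Hl; rewrite inE rl orbT.
by apply: C2FS_conseq3 Hq IHl (Cond_And s q (bigAnd l)); ptaut.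
Qed.

Lemma Sequentiality_bigOr l r :
  (forall p, p \in l -> C2FS (Imp p (Cond (Neg p) r))) ->
  C2FS (Imp (bigOr l) (Cond (Neg (bigOr l)) r)).
Proof.
elim: l => [_|q l IHl Hl]; first by apply: C2FS_taut; ptaut.
apply: Sequentiality_rule; first by apply: Hl; rewrite mem_head.
by apply: IHl => p pl; apply: Hl; rewrite inE pl orbT.
Qed.

Definition consistent (p : form) : Prop := ~ C2FS (Neg p).

Lemma consistentW p q :
  (forall v, peval v p -> peval v q) -> consistent p -> consistent q.
Proof.
move=> pq cp nq; apply: cp; apply: C2FS_conseq1 nq => v /=.
by apply: contra; exact: pq.
Qed.

Lemma inconsistentP p : ~ consistent p -> C2FS (Neg p).
Proof. by move=> /contrapT. Qed.

Section Atoms.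
Variable cl : seq form.

Definition atom : Type := {ffun seq_sub cl -> bool}.
HB.instance Definition _ := Finite.on atom.
Implicit Types (a b c : atom) (l : seq atom) (p q : form).

Definition atom_of (v : form -> bool) : atom := [ffun i => peval v (val i)].

Definition chi a : form :=
  bigAnd [seq if a i then val i else Neg (val i) | i <- enum {: seq_sub cl}].

Definition holds a p : bool := if insub p is Some i then a i else false.

Definition disj l : form := bigOr [seq chi a | a <- l].

Lemma peval_chi v a : peval v (chi a) = (a == atom_of v).
Proof.
rewrite peval_bigAnd all_map; apply/allP/eqP => [H|-> i _ /=].
  apply/ffunP => i; have /= := H i (mem_enum _ i); rewrite ffunE.
  by case: (a i) => //= /negPf.
by rewrite ffunE; case: ifP => //= ->.
Qed.

Lemma peval_disj v l : peval v (disj l) = (atom_of v \in l).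
Proof.
rewrite peval_bigOr has_map; apply/hasP/idP => [[a al /=]|vl].
  by rewrite peval_chi => /eqP <-.
by exists (atom_of v); rewrite //= peval_chi.
Qed.

Lemma holds_atom_of v p : p \in cl -> holds (atom_of v) p = peval v p.
Proof. by move=> pcl; rewrite /holds insubT/= ffunE. Qed.

Lemma chi_literal a p : p \in cl ->
  C2FS (Imp (chi a) (if holds a p then p else Neg p)).
Proof.
move=> pcl; apply: C2FS_taut => v /=; rewrite peval_chi.
by case: eqP => //= ->; rewrite holds_atom_of//; case: ifP => //= ->.
Qed.

Lemma consistent_valuation a t : consistent (chi a) -> C2FS t ->
  exists2 v, a = atom_of v & peval v t.
Proof.
move=> ca Ht; apply: contrapT => nex; apply: ca; apply: C2FS_conseq1 Ht => v vt /=.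
by rewrite peval_chi; apply/eqP => av; apply: nex; exists v.
Qed.

(* [a ∧ ¬□a ∧ (¬a ▷ b)] says that the first [¬a]-moment exists and is a
   [b]-moment, so [step] is the successor relation modulo stuttering; the loop
   at [a] is for sequences that stay in [a] forever. *)
Definition step : rel atom := fun a b =>
  `[< consistent (And (chi a)
        (And (Neg (Box (chi a))) (Cond (Neg (chi a)) (chi b)))) >] ||
  (a == b) && `[< consistent (And (chi a) (Box (chi a))) >].

Lemma step_source a b : step a b -> consistent (chi a).
Proof.
by case/orP => [/asboolP|/andP[_ /asboolP]]; apply: consistentW => v /= /andP[].
Qed.

Lemma step_target a b : step a b -> consistent (chi b).
Proof.
move=> ab; case/orP: (ab) => [/asboolP cab nb|/andP[/eqP <- _]]; last exact: step_source ab.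
have ba : C2FS (Imp (chi b) (chi a)) by apply: C2FS_conseq1 nb; ptaut.
apply: cab; apply: C2FS_conseq1 (Cond_mono (Neg (chi a)) ba); rewrite /Box; ptaut.
Qed.

Lemma connect_consistent a b :
  consistent (chi a) -> connect step a b -> consistent (chi b).
Proof.
move=> ca /connectP[p]; elim: p a ca => [|c p IHp] a ca /=; first by move=> _ ->.
by move=> /andP[/step_target cc]; exact: IHp.
Qed.

Lemma no_loop a : ~~ step a a -> C2FS (Imp (Box (chi a)) (Neg (chi a))).
Proof.
rewrite negb_or eqxx => /andP[_ /asboolPn/inconsistentP].
by apply: C2FS_conseq1; rewrite /Box; ptaut.
Qed.

Lemma chi_next_disj a l : (forall b, step a b -> b \in l) ->
  C2FS (Imp (chi a) (Cond (Neg (chi a)) (disj l))).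
Proof.
move=> suc; pose m := [seq Neg (chi c) | c <- enum {: atom} & c \notin l].
have H1 : C2FS (Imp (And (chi a) (Neg (Box (chi a))))
    (Cond (Neg (chi a)) (bigAnd m))).
  apply: Cond_bigAnd => q /mapP[c]; rewrite mem_filter => /andP[cl' _] ->.
  have : ~~ step a c by apply: contra cl'; exact: suc.
  rewrite negb_or => /andP[/asboolPn/inconsistentP H _].
  by apply: C2FS_conseq2 H (Cond_Neg (Neg (chi a)) (chi c)); rewrite /Box; ptaut.
have H2 : C2FS (Imp (bigAnd m) (disj l)).
  apply: C2FS_taut => v /=; rewrite peval_bigAnd peval_disj negb_and negbK orbC.
  have [//|vl /=] := boolP (_ \in l); apply/allPn; exists (Neg (chi (atom_of v))).
    by apply/mapP; exists (atom_of v); rewrite // mem_filter vl mem_enum.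
  by rewrite /= peval_chi eqxx.
have {H1 H2} H : C2FS (Imp (And (chi a) (Neg (Box (chi a))))
    (Cond (Neg (chi a)) (disj l))).
  by apply: C2FS_conseq2 H1 (Cond_mono (Neg (chi a)) H2); rewrite /Box; ptaut.
have [aa|/no_loop naa] := boolP (step a a).
  have /(Cond_mono (Neg (chi a))) : C2FS (Imp (chi a) (disj l)).
    apply: C2FS_taut => v /=; rewrite peval_chi peval_disj.
    by case: eqP => // <-; rewrite suc.
  by apply: C2FS_conseq2 H; rewrite /Box; ptaut.
by apply: C2FS_conseq2 H naa; rewrite /Box; ptaut.
Qed.

Lemma step_serial a : consistent (chi a) -> exists b, step a b.
Proof.
move=> ca; apply: contrapT => /forallNP noS; apply: ca.
have H : C2FS (Imp (chi a) (Cond (Neg (chi a)) (disj [::]))).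
  by apply: chi_next_disj => b /noS.
have /(Cond_mono (Neg (chi a))) H' : C2FS (Imp (disj [::]) (chi a)).
  by apply: C2FS_taut => v /=; case: (v _).
by apply: C2FS_conseq3 H H' (no_loop (introN idP (noS a))); rewrite /Box; ptaut.
Qed.

Lemma step_eventually a p q : p \in cl -> Cond p q \in cl ->
  consistent (chi a) -> ~~ holds a (Cond p q) ->
  exists2 b, connect step a b & holds b p.
Proof.
move=> pcl pqcl ca napq; apply: contrapT => nex; apply: ca.
pose l := enum (connect step a); pose D := disj l.
have HD : C2FS (Imp D (Box D)).
  apply: Sequentiality_bigOr => r /mapP[b]; rewrite mem_enum => ab ->.
  apply: chi_next_disj => c bc; rewrite mem_enum; apply: connect_trans ab _.
  exact: connect1.
have aD : C2FS (Imp (chi a) D).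
  apply: C2FS_taut => v /=; rewrite peval_chi peval_disj.
  by case: eqP => // <-; rewrite mem_enum inE connect0.
have pD : C2FS (Imp p (Neg D)).
  apply: C2FS_taut => v /=; rewrite peval_disj -holds_atom_of// negbK.
  rewrite mem_enum; apply/negP => /andP[vp av]; apply: nex.
  by exists (atom_of v).
have := chi_literal a pqcl; rewrite (negPf napq) => H.
have aBD : C2FS (Imp (chi a) (Box D)) by apply: C2FS_conseq2 aD HD; ptaut.
by apply: C2FS_conseq3 aBD (Box_vacuous q pD) H; ptaut.
Qed.

Lemma step_holds_Cond a b p q : p \in cl -> Cond p q \in cl ->
  step a b -> ~~ holds a p -> holds a (Cond p q) = holds b (Cond p q).
Proof.
move=> pcl pqcl + nap; case/orP => [/asboolP cab|/andP[/eqP <-]//].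
have := chi_literal a pcl; rewrite (negPf nap) => Hap.
have {}Hap : C2FS (Imp p (Neg (chi a))) by apply: C2FS_conseq1 Hap; ptaut.
have := Flattening_weaker q Hap => F.
have := chi_literal a pqcl; have /(Cond_mono (Neg (chi a))) := chi_literal b pqcl.
case: ifP => hb; case: ifP => ha // Hb Ha; exfalso; apply: cab.
  by apply: C2FS_conseq3 F Ha Hb; rewrite /Box; ptaut.
have G : C2FS (Imp (chi a) (Cond (Neg (chi a)) (Cond p q))).
  by apply: C2FS_conseq2 F Ha; ptaut.
apply: C2FS_conseq3 (Cond_contradiction (Neg (chi a)) (Cond p q) (chi a)) G Hb.
by rewrite /Box; ptaut.
Qed.

End Atoms.

Fixpoint subformulas (p : form) : seq form := p :: match p with
  | Atom _ => [::]
  | Neg p => subformulas p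
  | And p q | Cond p q => subformulas p ++ subformulas q
  end.

Lemma subformulas_refl p : p \in subformulas p.
Proof. by case: p => *; rewrite mem_head. Qed.

Lemma subformulas_trans q p r :
  p \in subformulas q -> q \in subformulas r -> p \in subformulas r.
Proof.
move=> pq; elim: r => [k|r IHr|r IHr s IHs|r IHr s IHs];
  rewrite [in X in X -> _]/= in_cons => /predU1P[<-//|] //=.
- by move/IHr => pr; rewrite inE pr orbT.
- by rewrite inE !mem_cat => /orP[/IHr|/IHs] ->; rewrite ?orbT.
- by rewrite inE !mem_cat => /orP[/IHr|/IHs] ->; rewrite ?orbT.
Qed.

Lemma consistent_labelling (phi : form) (a : atom (subformulas phi)) :
  consistent (chi a) ->
  exists (I : finType) (S : I -> I) (A : I -> form -> bool) (i0 : I),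
    Hintikka_labelling (fun p => p \in subformulas phi) S A /\
    A i0 phi = holds a phi.
Proof.
move=> ca; have [|I [S [L [i0 [c [Li0 eL allL]]]]]] := @lasso _ (@step _) a.
  by move=> b ab; apply: step_serial; exact: connect_consistent ab.
exists I, S, (fun i => holds (L i)), i0; split; last by rewrite Li0.
have cL i : consistent (chi (L i)) by exact: step_source (eL i).
have clNeg p : Neg p \in subformulas phi -> p \in subformulas phi.
  by apply: subformulas_trans; rewrite /= inE subformulas_refl orbT.
have clAnd p q : And p q \in subformulas phi ->
    p \in subformulas phi /\ q \in subformulas phi.
  by move=> pq; split; apply: subformulas_trans pq;
    rewrite /= inE mem_cat subformulas_refl ?orbT.
have clCond p q : Cond p q \in subformulas phi ->
    p \in subformulas phi /\ q \in subformulas phi.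
  by move=> pq; split; apply: subformulas_trans pq;
    rewrite /= inE mem_cat subformulas_refl ?orbT.
have next i p q : Cond p q \in subformulas phi -> ~~ holds (L i) p ->
    holds (L i) (Cond p q) = holds (L (S i)) (Cond p q).
  by move=> pq; apply: step_holds_Cond => //; case: (clCond _ _ pq).
split=> //.
- move=> i p np; have pcl := clNeg _ np.
  have [v -> _] := consistent_valuation (cL i) (C2FS_C2 (C2_Identity p)).
  by rewrite !holds_atom_of.
- move=> i p q pq; have [pcl qcl] := clAnd _ _ pq.
  have [v -> _] := consistent_valuation (cL i) (C2FS_C2 (C2_Identity p)).
  by rewrite !holds_atom_of.
- move=> i p q pq; have [pcl qcl] := clCond _ _ pq.
  have [v ->] := consistent_valuation (cL i) (Cond_centered p q).
  rewrite !holds_atom_of//= => + vp; rewrite vp.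
  by case: (v _); case: (peval v q).
- move=> i p q pq npq; have [pcl qcl] := clCond _ _ pq.
  apply: contrapT => /forallNP nop.
  have npqn n : ~~ holds (L (iter n S i)) (Cond p q).
    by elim: n => //= n IHn; rewrite -next//; apply/negP/nop.
  have [k Lk] := allL i c (connect0 _ c).
  have := npqn k; rewrite Lk => /(step_eventually pcl pq) [|d cd dp].
    by rewrite -Lk.
  by have [n Ln] := allL i d cd; apply: (nop n); rewrite Ln.
Qed.

Theorem theorem5p4 (p : form) :
  (forall (F : omega_frame), finite_omega_frame F ->
     forall (M : order_model), model_frame M = omega_order_frame F ->
     forall (w : M), true_at w p) ->
  C2FS p.
Proof.
move=> valid; apply: contrapT => np.
pose cl := subformulas p; have pcl : p \in cl := subformulas_refl p.
have [a ca nap] : exists2 a : atom cl, consistent (chi a) & ~~ holds a p.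
  apply: contrapT => nex; apply: np.
  pose G := [seq Neg (chi a) | a <- enum {: atom cl} & ~~ holds a p].
  apply: (@C2FS_consequence G) => [q /mapP[a]|v /allP vG].
    rewrite mem_filter => /andP[nap _] ->; apply: inconsistentP => ca.
    by apply: nex; exists a.
  rewrite -(holds_atom_of v pcl); apply: contrapT => /negP vp.
  have /vG /= : Neg (chi (atom_of cl v)) \in G.
    by apply/mapP; exists (atom_of cl v); rewrite // mem_filter vp mem_enum.
  by rewrite peval_chi eqxx.
have [I [S [A [i0 [HA Ap]]]]] := consistent_labelling ca.
have [F [finF [M [MF [w truth]]]]] := Hintikka_model HA i0.
have /(truth p pcl) := valid F finF M MF w.
by rewrite Ap (negPf nap).
Qed.
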